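(* Let $\Phi$ be a graph subspecies in which every graph is connected, and assume $\Phi$ is closed under creating and deleting endpoints. Let $\mathcal{A}$ be the species of rooted trees, $a$ the species of (unrooted) trees, $\Phi_{\mathcal{M}}$ the species of $\Phi$-graphs without endpoints, and $\Phi_{\mathcal{M}_{\ge 2}}$ the species of $\Phi_{\mathcal{M}}$-graphs on at least two vertices. Then $$\Phi=\begin{cases}\Phi_{\mathcal{M}_{\ge2}}\circ\mathcal{A}+a & \text{if the one-vertex graph is a }\Phi\text{-graph},\\ \Phi_{\mathcal{M}}\circ\mathcal{A} & \text{otherwise.}\end{cases}$$
   Context: Graphs are finite, simple, undirected; the empty graph is not considered connected. A graph subspecies $\Phi$ assigns to each finite set $U$ a set $\Phi[U]$ of graphs with vertex set $U$, preserved under relabeling; its members are $\Phi$-graphs. An endpoint is a vertex of degree exactly $1$; a graph without endpoints has no vertex of degree $1$. $\Phi$ is closed under creating and deleting endpoints if for every graph $G$ and every endpoint $v$ of $G$, $G$ is a $\Phi$-graph iff $G-v$ is a $\Phi$-graph. Species sum $\mathcal{F}+\mathcal{H}$ has structures the disjoint union $\mathcal{F}[U]\sqcup\mathcal{H}[U]$; for $\mathcal{H}[\emptyset]=\emptyset$, $(\mathcal{F}\circ\mathcal{H})$-structures on $U$ are pairs $(s,T)$ with $T$ a set of $\mathcal{H}$-structures whose label sets partition $U$ and $s\in\mathcal{F}[T]$. Equality of species means natural isomorphism (bijections commuting with relabeling). *)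

(* Defs.v *)
(* boolp's axioms are used for the extensionality of bijections and for the
   Boolean reflection of being a tree. *)
From HB Require Import structures.
From mathcomp Require Import all_boot boolp.

Set Implicit Arguments.
Unset Strict Implicit.
Unset Printing Implicit Defensive.

Record bij (U V : Type) := Bij {
  bfun :> U -> V;
  binv : V -> U;
  bfunK : cancel bfun binv;
  binvK : cancel binv bfun }.

Lemma bij_ext (U V : Type) (f g : bij U V) : f =1 g -> f = g.
Proof.
case: f g => [f f' fK f'K] [g g' gK g'K] /= /funext efg; subst g.
have efg' : f' = g' by apply: funext => y; rewrite -{1}(g'K y) fK.
by subst g'; rewrite (Prop_irrelevance fK gK) (Prop_irrelevance f'K g'K).
Qed.

Definition bij_id (U : Type) : bij U U :=
  @Bij U U id id (fun=> erefl) (fun=> erefl).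

Definition bij_comp (U V W : Type) (g : bij V W) (f : bij U V) : bij U W :=
  Bij (can_comp (bfunK g) (bfunK f)) (can_comp (binvK f) (binvK g)).

Definition bij_inv (U V : Type) (f : bij U V) : bij V U :=
  Bij (binvK f) (bfunK f).

Lemma bij_bijective (U V : Type) (f : bij U V) : bijective f.
Proof. exact: Bijective (bfunK f) (binvK f). Qed.

Lemma bij_inj (U V : Type) (f : bij U V) : injective f.
Proof. exact: can_inj (bfunK f). Qed.

(* Finite-set-valued functors on the groupoid of finite sets and bijections. *)
Record species := Species {
  struct :> finType -> finType;
  transport : forall U V : finType, bij U V -> struct U -> struct V;
  transport_id : forall (U : finType) (s : struct U),
    transport (bij_id U) s = s;
  transport_comp : forall (U V W : finType) (g : bij V W) (f : bij U V)
    (s : struct U), transport (bij_comp g f) s = transport g (transport f s) }.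

Arguments transport F {U V} f s : rename.

Definition species_iso (F G : species) : Prop :=
  exists phi : forall U : finType, F U -> G U,
    (forall U : finType, bijective (phi U)) /\
    (forall (U V : finType) (f : bij U V) (s : F U),
        phi V (transport F f s) = transport G f (phi U s)).

Section TransportBij.
Variables (F : species) (U V : finType) (f : bij U V).

Lemma transportK : cancel (transport F f) (transport F (bij_inv f)).
Proof.
move=> s; rewrite -transport_comp -[RHS]transport_id; congr transport.
by apply: bij_ext => x /=; rewrite bfunK.
Qed.

Lemma transportVK : cancel (transport F (bij_inv f)) (transport F f).
Proof.
move=> s; rewrite -transport_comp -[RHS]transport_id; congr transport.
by apply: bij_ext => x /=; rewrite binvK.
Qed.

Definition transport_bij : bij (F U) (F V) := Bij transportK transportVK.
End TransportBij.

Definition sum_transport (F H : species) (U V : finType) (f : bij U V)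
    (s : F U + H U) : F V + H V :=
  match s with
  | inl t => inl (transport F f t)
  | inr t => inr (transport H f t)
  end.

Lemma sum_transport_id (F H : species) (U : finType) (s : F U + H U) :
  sum_transport (bij_id U) s = s.
Proof. by case: s => s /=; rewrite transport_id. Qed.

Lemma sum_transport_comp (F H : species) (U V W : finType)
    (g : bij V W) (f : bij U V) (s : F U + H U) :
  sum_transport (bij_comp g f) s = sum_transport g (sum_transport f s).
Proof. by case: s => s /=; rewrite transport_comp. Qed.

Definition sum_species (F H : species) : species :=
  @Species (fun U : finType => (F U + H U)%type : finType)
    (@sum_transport F H) (@sum_transport_id F H) (@sum_transport_comp F H).

Section Restrict.
Variables (U V : finType) (f : bij U V) (B : {set U}).

Definition bij_restr_fun (x : {x : U | x \in B}) : {y : V | y \in f @: B} :=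
  exist _ (f (val x)) (imset_f f (valP x)).

Lemma bij_restr_inv_subproof (y : {y : V | y \in f @: B}) :
  binv f (val y) \in B.
Proof. by case: y => /= _ /imsetP[x xB ->]; rewrite bfunK. Qed.

Definition bij_restr_inv (y : {y : V | y \in f @: B}) : {x : U | x \in B} :=
  exist _ (binv f (val y)) (bij_restr_inv_subproof y).

Lemma bij_restr_funK : cancel bij_restr_fun bij_restr_inv.
Proof. by move=> x; apply: val_inj; rewrite /= bfunK. Qed.

Lemma bij_restr_invK : cancel bij_restr_inv bij_restr_fun.
Proof. by move=> y; apply: val_inj; rewrite /= binvK. Qed.

Definition bij_restr : bij {x : U | x \in B} {y : V | y \in f @: B} :=
  Bij bij_restr_funK bij_restr_invK.
End Restrict.

(* F-structures whose label set is some subset of U: pairs of B : {set U}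
   (the tag) and an F-structure on B. *)
Definition substruct (F : species) (U : finType) : finType :=
  {B : {set U} & F {x : U | x \in B}}.

Definition label_set (F : species) (U : finType) (s : substruct F U) :
  {set U} := tag s.

Definition substruct_transport (F : species) (U V : finType) (f : bij U V)
    (s : substruct F U) : substruct F V :=
  Tagged (fun C : {set V} => F {y : V | y \in C} : Type)
    (transport F (bij_restr f (tag s)) (tagged s)).

Lemma substruct_eq (F : species) (U : finType) (B C : {set U})
    (e : bij {x : U | x \in B} {x : U | x \in C}) (s : F {x : U | x \in B}) :
    (forall x, val (e x) = val x) ->
  Tagged (fun D : {set U} => F {x : U | x \in D} : Type) s =
  Tagged (fun D : {set U} => F {x : U | x \in D} : Type) (transport F e s).
Proof.
move=> eE; have eBC : B = C.
  apply/setP => x; apply/idP/idP => xB.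
    by have := eE (exist _ x xB) => /= <-; apply: valP.
  have := eE (binv e (exist _ x xB)); rewrite binvK /= => ->; exact: valP.
subst C; have -> : e = bij_id _ by apply: bij_ext => x; apply: val_inj.
by rewrite transport_id.
Qed.

Lemma substruct_transport_id (F : species) (U : finType) (s : substruct F U) :
  substruct_transport (bij_id U) s = s.
Proof. case: s => B s.
by rewrite [RHS](substruct_eq (e := bij_restr (bij_id U) B)). Qed.

Lemma substruct_transport_comp (F : species) (U V W : finType)
    (g : bij V W) (f : bij U V) (s : substruct F U) :
  substruct_transport (bij_comp g f) s =
  substruct_transport g (substruct_transport f s).
Proof.
case: s => B s; rewrite /substruct_transport /= -transport_comp.
set b1 := bij_restr _ _; set b2 := bij_comp _ _.
rewrite (substruct_eq (e := bij_comp b2 (bij_inv b1))); last first.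
  by move=> x; rewrite /= !binvK.
rewrite -transport_comp.
suff -> : bij_comp (bij_comp b2 (bij_inv b1)) b1 = b2 by [].
by apply: bij_ext => x; apply: val_inj; rewrite /= !bfunK.
Qed.

Definition substruct_species (F : species) : species :=
  @Species (substruct F) (@substruct_transport F)
    (@substruct_transport_id F) (@substruct_transport_comp F).

Definition labels_partition (H : species) (U : finType)
    (T : {set substruct H U}) : bool :=
  dinjectiveb (@label_set H U) (mem T) &&
  partition [set label_set t | t in T] [set: U].

Lemma labels_partition_imset (H : species) (U V : finType) (f : bij U V)
    (T : {set substruct H U}) :
  labels_partition T ->
  labels_partition (transport_bij (substruct_species H) f @: T).
Proof.
move=> /andP[/dinjectiveP Tinj /and3P[/eqP Tcov Ttriv T0]].
have tagE (t : substruct H U) :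
  label_set (transport (substruct_species H) f t) = f @: label_set t by [].
have finj := @bij_inj _ _ f.
apply/andP; split.
  apply/dinjectiveP => _ _ /imsetP[s sT ->] /imsetP[t tT ->] /= e.
  by congr (substruct_transport f _); apply: Tinj => //; exact: imset_inj e.
have -> : [set label_set t | t in transport_bij (substruct_species H) f @: T] =
    [set f @: (B : {set U}) | B in [set label_set t | t in T]].
  by rewrite -!imset_comp; apply: eq_imset.
have -> : [set: V] = f @: [set: U].
  apply/setP => y; rewrite inE; apply/esym/imsetP; exists (binv f y) => //.
  by rewrite binvK.
by rewrite (imset_partition _ _ finj); apply/and3P; split => //; apply/eqP.
Qed.

(* An (F o H)-structure on U: a set T of H-structures whose label sets
   partition U, with an F-structure on T. The blocks of a MathComp partition
   are nonempty, so only the H-structures on nonempty sets are used: this is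
   the usual composition as soon as H has no structure on the empty set. *)
Definition comp_struct (F H : species) (U : finType) : finType :=
  {s : substruct F (substruct H U) | labels_partition (label_set s)}.

Definition comp_transport (F H : species) (U V : finType) (f : bij U V)
    (s : comp_struct F H U) : comp_struct F H V :=
  exist _ (substruct_transport (transport_bij (substruct_species H) f) (val s))
    (labels_partition_imset f (valP s)).

Lemma comp_transport_id (F H : species) (U : finType)
    (s : comp_struct F H U) : comp_transport (bij_id U) s = s.
Proof.
apply: val_inj => /=; rewrite -[RHS]substruct_transport_id.
congr substruct_transport; apply: bij_ext => t; exact: substruct_transport_id.
Qed.

Lemma comp_transport_comp (F H : species) (U V W : finType)
    (g : bij V W) (f : bij U V) (s : comp_struct F H U) :
  comp_transport (bij_comp g f) s = comp_transport g (comp_transport f s).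
Proof.
apply: val_inj => /=; rewrite -substruct_transport_comp.
congr substruct_transport; apply: bij_ext => t; exact: substruct_transport_comp.
Qed.

Definition comp_species (F H : species) : species :=
  @Species (comp_struct F H) (@comp_transport F H)
    (@comp_transport_id F H) (@comp_transport_comp F H).

(* A simple graph with vertex set U, as its symmetric and irreflexive set of
   ordered pairs of adjacent vertices. *)
Definition simple_arcs (U : finType) (E : {set U * U}) : bool :=
  [forall x, (x, x) \notin E] &&
  [forall x, forall y, ((x, y) \in E) ==> ((y, x) \in E)].

Record sgraph (U : finType) := SGraph {
  arcs :> {set U * U};
  arcsP : simple_arcs arcs }.

HB.instance Definition _ (U : finType) := [isSub for @arcs U].
HB.instance Definition _ (U : finType) := [Finite of sgraph U by <:].

Definition adj (U : finType) (G : sgraph U) : rel U :=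
  fun x y => (x, y) \in arcs G.

Lemma adj_sym (U : finType) (G : sgraph U) : symmetric (adj G).
Proof.
have /andP[_ /forallP sE] := arcsP G; move=> x y.
have {}sE u v : (u, v) \in arcs G -> (v, u) \in arcs G.
  by move: (sE u) => /forallP/(_ v)/implyP.
by apply/idP/idP; exact: sE.
Qed.

Lemma adj_irr (U : finType) (G : sgraph U) : irreflexive (adj G).
Proof. by have /andP[/forallP iE _] := arcsP G; move=> x; apply/negbTE/iE. Qed.

Lemma sgraph_ext (U : finType) (G1 G2 : sgraph U) : adj G1 =2 adj G2 -> G1 = G2.
Proof. by move=> e; apply: val_inj; apply/setP => -[x y]; exact: e. Qed.

Section PullBack.
Variables (U V : finType) (h : V -> U) (G : sgraph U).

Lemma pullback_subproof :
  simple_arcs [set p : V * V | adj G (h p.1) (h p.2)].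
Proof.
apply/andP; split; first by apply/forallP => x; rewrite inE adj_irr.
by apply/forallP => x; apply/forallP => y; rewrite !inE adj_sym implybb.
Qed.

Definition pullback : sgraph V := SGraph pullback_subproof.

Lemma adj_pullback x y : adj pullback x y = adj G (h x) (h y).
Proof. by rewrite /adj inE. Qed.
End PullBack.

Definition relabel (U V : finType) (f : bij U V) (G : sgraph U) : sgraph V :=
  pullback (binv f) G.

Definition delete_vertex (U : finType) (G : sgraph U) (v : U) :
    sgraph {x : U | x != v} :=
  pullback (fun x : {x : U | x != v} => val x) G.

Definition degree (U : finType) (G : sgraph U) (v : U) : nat :=
  #|[set x | adj G v x]|.

Definition endpoint (U : finType) (G : sgraph U) (v : U) : bool :=
  degree G v == 1.

Definition connected (U : finType) (G : sgraph U) : bool :=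
  (0 < #|U|) && [forall x, forall y, connect (adj G) x y].

Definition acyclic (U : finType) (G : sgraph U) : Prop :=
  forall c : seq U, 2 < size c -> ~ ucycle (adj G) c.

Definition is_tree (U : finType) (G : sgraph U) : Prop :=
  connected G /\ acyclic G.

Lemma relabel_id (U : finType) (G : sgraph U) : relabel (bij_id U) G = G.
Proof. by apply: sgraph_ext => x y; rewrite adj_pullback. Qed.

Lemma relabel_comp (U V W : finType) (g : bij V W) (f : bij U V)
    (G : sgraph U) : relabel (bij_comp g f) G = relabel g (relabel f G).
Proof. by apply: sgraph_ext => x y; rewrite !adj_pullback. Qed.

Lemma adj_relabel (U V : finType) (f : bij U V) (G : sgraph U) (x y : U) :
  adj (relabel f G) (f x) (f y) = adj G x y.
Proof. by rewrite adj_pullback !bfunK. Qed.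

Lemma bij_card (U V : finType) (f : bij U V) : #|U| = #|V|.
Proof. exact: bij_eq_card (bij_bijective f). Qed.

Lemma endpoint_relabel (U V : finType) (f : bij U V) (G : sgraph U) (x : U) :
  endpoint (relabel f G) (f x) = endpoint G x.
Proof.
rewrite /endpoint /degree -(card_imset _ (@bij_inj _ _ f)).
congr (_ == _); apply: eq_card => y; rewrite inE -(binvK f y) adj_relabel.
by rewrite (mem_imset _ _ (@bij_inj _ _ f)) inE.
Qed.

Lemma connected_relabel (U V : finType) (f : bij U V) (G : sgraph U) :
  connected G -> connected (relabel f G).
Proof.
move=> /andP[U0 /forallP Gc]; apply/andP; split; first by rewrite -(bij_card f).
apply/forallP => x; apply/forallP => y.
have /forallP/(_ (binv f y))/connectP[p pp py] := Gc (binv f x).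
apply/connectP; exists (map f p).
  rewrite -{1}(binvK f x) path_map; apply: sub_path pp => u v.
  by rewrite /relpre /= adj_relabel.
by rewrite -{1}(binvK f x) last_map -py binvK.
Qed.

Lemma is_tree_relabel (U V : finType) (f : bij U V) (G : sgraph U) :
  is_tree G -> is_tree (relabel f G).
Proof.
move=> [Gc Ga]; split; first exact: connected_relabel.
move=> c c2 /andP[cc cu]; apply: (Ga (map (binv f) c)); first by rewrite size_map.
apply/andP; split; last by rewrite (map_inj_uniq (can_inj (binvK f))).
rewrite cycle_map; apply: sub_cycle cc => u v.
by rewrite adj_pullback.
Qed.

Record graph_subspecies := GraphSubspecies {
  graphs :> forall U : finType, {set sgraph U};
  graphs_relabel : forall (U V : finType) (f : bij U V) (G : sgraph U),
    G \in graphs U -> relabel f G \in graphs V }.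

Section SpeciesOfSubspecies.
Variable Phi : graph_subspecies.

Definition graph_struct (U : finType) : finType :=
  {G : sgraph U | G \in Phi U}.

Definition graph_transport (U V : finType) (f : bij U V)
    (s : graph_struct U) : graph_struct V :=
  exist _ (relabel f (val s)) (graphs_relabel f (valP s)).

Lemma graph_transport_id (U : finType) (s : graph_struct U) :
  graph_transport (bij_id U) s = s.
Proof. by apply: val_inj; exact: relabel_id. Qed.

Lemma graph_transport_comp (U V W : finType) (g : bij V W) (f : bij U V)
    (s : graph_struct U) :
  graph_transport (bij_comp g f) s = graph_transport g (graph_transport f s).
Proof. by apply: val_inj; exact: relabel_comp. Qed.

Definition species_of : species :=
  Species graph_transport_id graph_transport_comp.
End SpeciesOfSubspecies.

Definition all_connected (Phi : graph_subspecies) : Prop :=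
  forall (U : finType) (G : sgraph U), G \in Phi U -> connected G.

Definition endpoint_closed (Phi : graph_subspecies) : Prop :=
  forall (U : finType) (G : sgraph U) (v : U), endpoint G v ->
    (G \in Phi U <-> delete_vertex G v \in Phi {x : U | x != v}).

Lemma edgeless_subproof (U : finType) : simple_arcs (set0 : {set U * U}).
Proof.
apply/andP; split; first by apply/forallP => x; rewrite in_set0.
by apply/forallP => x; apply/forallP => y; rewrite !in_set0.
Qed.

Definition edgeless (U : finType) : sgraph U := SGraph (edgeless_subproof U).

Definition one_vertex_graph : sgraph unit := edgeless unit.

Section NoEndpoints.
Variable Phi : graph_subspecies.

Definition no_endpoint_graphs (U : finType) : {set sgraph U} :=
  [set G in Phi U | [forall v, ~~ endpoint G v]].

Lemma no_endpoint_graphs_relabel (U V : finType) (f : bij U V)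
    (G : sgraph U) :
  G \in no_endpoint_graphs U -> relabel f G \in no_endpoint_graphs V.
Proof.
rewrite !inE => /andP[GP /forallP Ge]; rewrite graphs_relabel //=.
by apply/forallP => v; rewrite -(binvK f v) endpoint_relabel.
Qed.

Definition no_endpoints : graph_subspecies :=
  GraphSubspecies no_endpoint_graphs_relabel.
End NoEndpoints.

Section AtLeastTwo.
Variable Phi : graph_subspecies.

Definition at_least_two_graphs (U : finType) : {set sgraph U} :=
  [set G in Phi U | 2 <= #|U|].

Lemma at_least_two_graphs_relabel (U V : finType) (f : bij U V)
    (G : sgraph U) :
  G \in at_least_two_graphs U -> relabel f G \in at_least_two_graphs V.
Proof.
by rewrite !inE => /andP[GP U2]; rewrite graphs_relabel //= -(bij_card f).
Qed.

Definition at_least_two : graph_subspecies :=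
  GraphSubspecies at_least_two_graphs_relabel.
End AtLeastTwo.

Definition tree_graphs (U : finType) : {set sgraph U} :=
  [set G : sgraph U | `[< is_tree G >]].

Lemma tree_graphs_relabel (U V : finType) (f : bij U V) (G : sgraph U) :
  G \in tree_graphs U -> relabel f G \in tree_graphs V.
Proof. by rewrite !inE => /asboolP Gt; apply/asboolP; exact: is_tree_relabel. Qed.

Definition tree_subspecies : graph_subspecies :=
  GraphSubspecies tree_graphs_relabel.

Definition tree_species : species := species_of tree_subspecies.

Definition rooted_transport (U V : finType) (f : bij U V)
    (s : tree_species U * U) : tree_species V * V :=
  (transport tree_species f s.1, f s.2).

Lemma rooted_transport_id (U : finType) (s : tree_species U * U) :
  rooted_transport (bij_id U) s = s.
Proof. by case: s => t r; rewrite /rooted_transport transport_id. Qed.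

Lemma rooted_transport_comp (U V W : finType) (g : bij V W) (f : bij U V)
    (s : tree_species U * U) :
  rooted_transport (bij_comp g f) s = rooted_transport g (rooted_transport f s).
Proof. by case: s => t r; rewrite /rooted_transport transport_comp. Qed.

Definition rooted_tree_species : species :=
  @Species (fun U : finType => (tree_species U * U)%type : finType)
    rooted_transport rooted_transport_id rooted_transport_comp.

Lemma rooted_tree_empty (U : finType) :
  #|U| = 0 -> #|{: rooted_tree_species U}| = 0.
Proof. by move=> U0; rewrite card_prod U0 muln0. Qed.

(* Main.v *)
(* The core of a connected graph is the largest vertex set inducing minimum
   degree at least 2; it is empty exactly for trees. Off the core, the edges form
   disjoint trees, each containing exactly one core vertex, its root: a further
   core vertex, or a cycle, in such a branch would enlarge the core. Hence a
   non-tree is the same thing as its core together with the rooted trees attached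
   to it. Deleting endpoints one at a time leads from a graph to its core and
   back, so closure under creating and deleting endpoints makes the graph a
   Phi-graph if and only if its core is one; likewise a tree is a Phi-graph if
   and only if the one-vertex graph is. *)
Require Import Defs.
From mathcomp Require Import all_boot.
From mathcomp Require Import boolp.

Set Implicit Arguments.
Unset Strict Implicit.
Unset Printing Implicit Defensive.

(** * Bijections, inverse isomorphisms and pullbacks along injections *)

Lemma inj_surj_bij (A B : finType) (f : A -> B) :
  injective f -> (forall y, exists x, f x = y) -> bijective f.
Proof.
move=> finj fsurj.
have fsurjb y : exists x, f x == y by have [x <-] := fsurj y; exists x.
exists (fun y => xchoose (fsurjb y)) => [x|y]; last exact: (eqP (xchooseP (fsurjb y))).
by apply: finj; exact: (eqP (xchooseP (fsurjb (f x)))).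
Qed.

Lemma species_iso_sym (F G : species) : species_iso F G -> species_iso G F.
Proof.
case=> phi [phi_bij phi_nat].
have ex U (y : G U) : exists x, phi U x == y.
  by have [g _ gK] := phi_bij U; exists (g y); rewrite gK.
pose psi U y := xchoose (ex U y).
have psiK U : cancel (psi U) (phi U) by move=> y; exact: (eqP (xchooseP (ex U y))).
have phiK U : cancel (phi U) (psi U).
  by move=> x; apply: (ssrfun.bij_inj (phi_bij U)); rewrite psiK.
exists psi; split=> [U|U V f s]; first exact: Bijective (psiK U) (phiK U).
by apply: (ssrfun.bij_inj (phi_bij V)); rewrite phi_nat !psiK.
Qed.

Lemma bij_of_injections (A B : finType) (U : eqType) (i : A -> U) (j : B -> U) :
    injective i -> injective j -> codom i =i codom j ->
  exists e : bij A B, forall a, j (e a) = i a.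
Proof.
move=> i_inj j_inj eij.
have ex1 a : exists b, j b == i a.
  by have := codom_f i a; rewrite eij => /codomP[b ->]; exists b.
have ex2 b : exists a, i a == j b.
  by have := codom_f j b; rewrite -eij => /codomP[a ->]; exists a.
pose f a := xchoose (ex1 a); pose g b := xchoose (ex2 b).
have fE a : j (f a) = i a by exact: (eqP (xchooseP (ex1 a))).
have gE b : i (g b) = j b by exact: (eqP (xchooseP (ex2 b))).
have fK : cancel f g by move=> a; apply: i_inj; rewrite gE fE.
have gK : cancel g f by move=> b; apply: j_inj; rewrite fE gE.
by exists (Bij fK gK).
Qed.

(** Two injections with the same image differ by a bijection of their domains, so the two pullbacks
    are relabelings of each other. This carries membership between nested subtypes, or between trees
    and their roots. *)
Lemma pullback_graphs (Phi : graph_subspecies) (U A B : finType) (G : sgraph U)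
    (i : A -> U) (j : B -> U) :
    injective i -> injective j -> codom i =i codom j ->
  pullback i G \in Phi A -> pullback j G \in Phi B.
Proof.
move=> i_inj j_inj eij iP; have [e eE] := bij_of_injections i_inj j_inj eij.
have -> : pullback j G = relabel e (pullback i G); last exact: graphs_relabel.
by apply: sgraph_ext => x y; rewrite !adj_pullback -!eE !binvK.
Qed.

(** * The core and its relation to cycles *)

Section Core.
Variables (U : finType) (G : sgraph U).
Implicit Types (x y r : U) (C D : {set U}) (c p : seq U).

Definition induced D : sgraph {x : U | x \in D} :=
  pullback (fun x : {x : U | x \in D} => val x) G.

Definition nbrs_in D x : {set U} := [set y in D | adj G x y].

Definition min_degree2 D : bool := [forall x in D, 1 < #|nbrs_in D x|].

(** The 2-core, written as the union of all vertex sets that induce minimum degree at least 2. *)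
Definition core : {set U} :=
  [set x | [exists D : {set U}, (x \in D) && min_degree2 D]].

Lemma nbrs_inP D x :
  reflect (exists y z, [/\ y \in D, z \in D, adj G x y, adj G x z & y != z])
          (1 < #|nbrs_in D x|).
Proof.
apply: (iffP card_gt1P) => [[y [z []]]|[y [z [yD zD xy xz yz]]]].
  by rewrite !inE => /andP[yD xy] /andP[zD xz] yz; exists y, z.
by exists y, z; rewrite !inE yD zD.
Qed.

Lemma nbrs_inS D D' x : D \subset D' -> nbrs_in D x \subset nbrs_in D' x.
Proof.
by move=> /subsetP sD; apply/subsetP => y; rewrite !inE => /andP[/sD-> ->].
Qed.

Lemma min_degree2_sub_core D : min_degree2 D -> D \subset core.
Proof.
by move=> D2; apply/subsetP => x xD; rewrite inE; apply/existsP; exists D; rewrite xD.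
Qed.

Lemma core_min_degree2 : min_degree2 core.
Proof.
apply/forall_inP => x; rewrite inE => /existsP[D /andP[xD D2]].
apply: leq_trans (forall_inP D2 _ xD) _.
exact/subset_leq_card/nbrs_inS/min_degree2_sub_core.
Qed.

Lemma core_eq0 : (forall D, D != set0 -> ~~ min_degree2 D) -> core = set0.
Proof.
move=> nD; apply/eqP/negPn/negP => /nD/negP; apply; exact: core_min_degree2.
Qed.

Lemma degree_induced D (v : {x : U | x \in D}) :
  degree (induced D) v = #|nbrs_in D (val v)|.
Proof.
rewrite /degree -(card_imset _ val_inj); apply: eq_card => y; rewrite inE.
apply/imsetP/andP => [[w]|[yD vy]].
  by rewrite inE adj_pullback => vw ->; split; [exact: valP|].
by exists (exist _ y yD) => //; rewrite inE adj_pullback.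
Qed.

(** Rotated to start at [x], the cycle offers its second and its last vertex as neighbours of [x];
    they differ because the length exceeds 2. *)
Lemma ucycle_min_degree2 c :
  2 < size c -> ucycle (adj G) c -> min_degree2 [set x in c].
Proof.
move=> c2 /andP[cc cu]; apply/forall_inP => x; rewrite inE => xc.
have [i s sE] := rot_to xc.
have : cycle (adj G) (x :: s) by rewrite -sE rot_cycle.
have : uniq (x :: s) by rewrite -sE rot_uniq.
have : 2 < size (x :: s) by rewrite -sE size_rot.
have mE y : (y \in c) = (y \in x :: s) by rewrite -sE mem_rot.
case: s {sE} mE => // y s; case/lastP: s => // s z mE _.
rewrite /= rcons_path last_rcons mem_rcons !inE => /and3P[_ /norP[yz _] _].
move=> /and3P[xy _ zx]; apply/nbrs_inP; exists y, z.
by rewrite !inE !mE !inE !mem_rcons !inE !eqxx !orbT xy adj_sym zx yz.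
Qed.

(* A longest path growing at its head [x] must close a cycle; if some vertex of
   [D] is adjacent to [r], the path is made to contain [r]
   from the outset, so that no extension steps onto [r]. *)
Lemma acyclic_subset1 r D : acyclic G ->
    (forall x, x \in D -> x != r -> 1 < #|nbrs_in D x|) -> D \subset [set r].
Proof.
move=> Ga D2; apply/subsetP => v vD; rewrite inE; apply/negPn/negP => vr.
pose k := [exists u in D, adj G u r].
have long n : exists x p,
    [/\ x \in D, x != r, path (adj G) x p, uniq (x :: p) & n <= size p] /\
    (k -> r \in p).
  elim: n => [|n [x [p [[xD xr xp xu pn] kr]]]].
    have [/exists_inP[u uD ur]|k0] := boolP k; last by exists v, [::].
    have u_r : u != r by apply: contraTneq ur => ->; rewrite adj_irr.
    by exists u, [:: r]; rewrite /= !inE ur u_r eqxx.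
  have [y [z [yD zD xy xz yz]]] := nbrs_inP _ _ (D2 x xD xr).
  have [w [wD xw wp]] : exists w, [/\ w \in D, adj G x w & w != head x p].
    have [yp|yp] := eqVneq y (head x p); last by exists y.
    by exists z; rewrite -yp eq_sym.
  have w_x : w != x by apply: contraTneq xw => ->; rewrite adj_irr.
  have [w_p|w_p] := boolP (w \in p).
    case: p xp xu wp w_p {kr pn} => // y' p /andP[xy' y'p] xu wy'.
    rewrite inE (negPf wy') /= => w_p; case/path.splitP: w_p y'p xu => p1 p2.
    rewrite -/(path _ _ _) cat_path => /andP[y'p1 _]; rewrite -!cat_cons cat_uniq.
    move=> /andP[p1u _]; exfalso.
    apply: (Ga (x :: y' :: rcons p1 w)); first by rewrite /= size_rcons.
    apply/andP; split=> //.
    by rewrite /= rcons_path xy' y'p1 last_rcons adj_sym xw.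
  have w_r : w != r.
    apply: contraNneq w_p => wr; rewrite wr; apply: kr; apply/existsP.
    by exists x; rewrite xD -wr.
  exists w, (x :: p); rewrite wD w_r /= adj_sym xw xp inE (negPf w_x) w_p.
  by split=> [|/kr rp]; [|rewrite inE rp orbT].
(* A duplicate-free list [x :: p] with [p] of size at least [#|U|] has too many vertices. *)
have [x [p [[_ _ _ xu pn] _]]] := long #|U|.
by have := uniq_leq_size xu (fun y _ => mem_enum U y); rewrite -cardE ltnNge pn.
Qed.

(** A nonempty set of minimum degree 2 in an acyclic graph would shrink to any chosen [r] in it,
    leaving [r] only itself as a neighbour. Conversely, every cycle lies in the core. *)
Lemma acyclicP : acyclic G <-> core = set0.
Proof.
split=> [Ga|C0 c c2 cc].
  apply: core_eq0 => D /set0Pn[r rD]; apply/negP => /forall_inP D2.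
  have /subsetP Dr : D \subset [set r] by apply: acyclic_subset1 => // x /D2.
  have /nbrs_inP[y [z [/Dr]]] := D2 r rD.
  by rewrite inE => /eqP-> _; rewrite adj_irr.
have := min_degree2_sub_core (ucycle_min_degree2 c2 cc).
rewrite C0 subset0 => /eqP/setP.
by case: c c2 {cc} => // x c _ /(_ x); rewrite !inE eqxx.
Qed.

Lemma connected_degree_gt1 :
  connected G -> 1 < #|U| -> (forall v, ~~ endpoint G v) -> forall v, 1 < degree G v.
Proof.
move=> /andP[_ /forallP Gc] U1 Ge v; have := Ge v.
rewrite /endpoint ltn_neqAle eq_sym => -> /=.
have [y yv] : exists y, y != v.
  have /card_gt1P[y [z [_ _ yz]]] := U1.
  by have [yv|] := eqVneq y v; [exists z; rewrite -yv eq_sym|exists y].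
have /forallP/(_ y)/connectP[[|z p]] := Gc v.
  by move=> _ /= /eqP; rewrite (negPf yv).
by move=> /andP[vz _] _; apply/card_gt0P; exists z; rewrite inE.
Qed.

Lemma card_core : core != set0 -> 1 < #|core|.
Proof.
case/set0Pn=> x xC; have /forall_inP/(_ x xC) := core_min_degree2.
by move=> /leq_trans; apply; apply/subset_leq_card/subsetP => y; rewrite inE => /andP[].
Qed.

(** Two neighbours in [D] would be joined by a path inside [D], which closes through [v] to a cycle
    and so puts [v] in the core. *)
Lemma core_unique_nbr D v :
    connected (induced D) -> v \notin D -> v \notin core ->
    0 < #|nbrs_in D v| -> #|nbrs_in D v| = 1.
Proof.
move=> /andP[_ /forallP Dc] vD vC v1; apply/eqP; rewrite eqn_leq v1 andbT leqNgt.
apply: contra vC => /nbrs_inP[u [w [uD wD vu vw uw]]].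
have /forallP/(_ (exist _ w wD))/connectP[p0 p0p] := Dc (exist _ u uD).
case/shortenP: p0p => p pp pu _ wE.
have wE' : w = last u (map val p) by rewrite (last_map val p (exist _ u uD)) -wE.
have vp : v \notin u :: map val p.
  rewrite -[u :: _]/(map val (exist _ u uD :: p)); apply/mapP => -[[z zD] _ /= vz].
  by rewrite vz zD in vD.
suff cyc : ucycle (adj G) [:: v, u & map val p].
  apply: (subsetP (min_degree2_sub_core (ucycle_min_degree2 _ cyc))).
    by case: (p) wE' => // /= wu; rewrite wu eqxx in uw.
  by rewrite !inE eqxx.
apply/andP; split.
  rewrite /= rcons_path vu -wE' [adj G w v]adj_sym vw andbT.
  rewrite -[u]/(val (exist (fun x => x \in D) u uD)) path_map.
  by apply: sub_path pp => a b; rewrite /= adj_pullback.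
by rewrite cons_uniq vp -[u :: _]/(map val (exist _ u uD :: p)) (map_inj_uniq val_inj).
Qed.

End Core.

(** * Deleting endpoints down to the core and creating them again *)

Section Pruning.
Variables (Phi : graph_subspecies).
Hypotheses (Phi_connected : all_connected Phi) (Phi_closed : endpoint_closed Phi).
Variables (U : finType) (G : sgraph U).
Implicit Types (v : U) (D : {set U}).

(** Here [v] is an endpoint of the graph induced on [D]. Deleting it gives a graph on a nested
    subtype, whose image in [U] is that of the subtype on [D :\ v]. *)
Lemma induced_setD1 D v : v \in D -> #|nbrs_in G D v| = 1 ->
  (induced G D \in Phi _) = (induced G (D :\ v) \in Phi _).
Proof.
move=> vD v1; pose v' : {x : U | x \in D} := exist _ v vD.
have v'e : endpoint (induced G D) v' by rewrite /endpoint degree_induced v1.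
pose j (x : {x : {x : U | x \in D} | x != v'}) : U := val (val x).
have j_inj : injective j by apply: inj_comp; exact: val_inj.
have delE : delete_vertex (induced G D) v' = pullback j G.
  by apply: sgraph_ext => x y; rewrite !adj_pullback.
have codE : codom j =i codom (fun x : {x : U | x \in D :\ v} => val x).
  move=> x; apply/codomP/codomP => -[[y yD] ->].
    suff jD : j (exist _ y yD) \in D :\ v by exists (exist (fun x => x \in D :\ v) _ jD).
    by rewrite !inE (valP y) andbT; apply: contraNneq (yD) => yv; apply/eqP/val_inj.
  have := yD; rewrite !inE => /andP[yv yD'].
  have yv' : (exist _ y yD' : {x : U | x \in D}) != v' by rewrite -val_eqE.
  by exists (exist (fun x => x != v') _ yv').
apply/idP/idP => [/(Phi_closed v'e)|DP].
  by rewrite delE; apply: pullback_graphs => //; exact: val_inj.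
apply/(Phi_closed v'e); rewrite delE; move: DP.
by apply: pullback_graphs => //; exact: val_inj.
Qed.

Lemma pullback_bij (A : finType) (i : A -> U) :
  injective i -> codom i =i U -> (pullback i G \in Phi A) = (G \in Phi U).
Proof.
move=> i_inj i_full; have GE : pullback id G = G.
  by apply: sgraph_ext => x y; rewrite adj_pullback.
have codE : codom i =i codom (fun x : U => x).
  by move=> x; rewrite i_full; apply/esym/codomP; exists x.
by rewrite -[in RHS]GE; apply/idP/idP; apply: pullback_graphs.
Qed.

Lemma induced_setT : (induced G setT \in Phi _) = (G \in Phi U).
Proof.
apply: pullback_bij => [|x]; first exact: val_inj.
by apply/codomP; exists (exist (fun x => x \in setT) x (in_setT x)).
Qed.

(** A smallest admissible [D] has no endpoint: core vertices keep two neighbours in [D], and an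
    endpoint off the core could be deleted. Being connected, [D] then has minimum degree 2 or a
    single vertex. *)
Lemma exists_pruned : G \in Phi U ->
  exists D, [/\ core G \subset D, induced G D \in Phi _ &
                min_degree2 G D \/ exists r, D = [set r]].
Proof.
move=> GP; pose P D := (core G \subset D) && (induced G D \in Phi _).
have PT : P setT by rewrite /P subsetT induced_setT.
case: (arg_minnP (fun D => #|D|) PT) => D /andP[CD DP] Dmin.
exists D; split=> //; have Dc := Phi_connected DP.
have [D1|] := ltnP 1 #|D|.
  left; apply/forall_inP => x xD; rewrite -(degree_induced G (exist _ x xD)).
  apply: connected_degree_gt1; rewrite ?card_sig // => -[v vD]; apply/negP.
  rewrite /endpoint degree_induced /= => /eqP v1.
  have vC : v \notin core G.
    apply/negP => /(forall_inP (core_min_degree2 G)).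
    by rewrite ltnNge (leq_trans (subset_leq_card (nbrs_inS _ _ CD))) ?v1.
  have /Dmin : P (D :\ v).
    by rewrite /P -induced_setD1 // DP subsetD1 CD vC.
  by rewrite (cardsD1 v D) vD ltnn.
rewrite leq_eqVlt ltnS leqn0 => /orP[/cards1P|]; first by right.
by move: Dc => /andP[+ _]; rewrite card_sig lt0n => /negP.
Qed.

(** In a largest admissible [E], any outside vertex adjacent to [E] would have exactly one neighbour
    there and could be added as an endpoint. So [E] is closed under adjacency, and connectedness
    makes it everything. *)
Lemma regrow D : connected G -> D != set0 -> core G \subset D ->
  induced G D \in Phi _ -> G \in Phi U.
Proof.
move=> /andP[_ /forallP Gc] D0 CD DP.
pose P (E : {set U}) := (D \subset E) && (induced G E \in Phi _).
have PD : P D by rewrite /P subxx.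
case: (arg_maxnP (fun E : {set U} => #|E|) PD) => E /andP[DE EP] Emax.
suff ET : E = setT by rewrite -induced_setT -ET.
have E_out v u : v \notin E -> u \in E -> ~~ adj G v u.
  move=> vE uE; apply/negP => vu.
  have v1 : #|nbrs_in G E v| = 1.
    apply: core_unique_nbr => //; first exact: Phi_connected EP.
      by apply: contra vE; apply/subsetP/(subset_trans CD).
    by apply/card_gt0P; exists u; rewrite inE uE.
  have nE : nbrs_in G (v |: E) v = nbrs_in G E v.
    by apply/setP => y; rewrite !inE; case: eqVneq => //= ->; rewrite adj_irr andbF.
  have /Emax : P (v |: E).
    rewrite /P subsetU ?DE ?orbT //= (induced_setD1 (v := v)) ?setU1K //.
      by rewrite setU11.
    by rewrite nE.
  by rewrite /= cardsU1 vE add1n ltnn.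
have [d /(subsetP DE) dE] := set0Pn _ D0.
have Ecl : closed (adj G) (mem E).
  apply: intro_closed => [|x y xy xE].
    by apply: sym_connect_sym; exact: adj_sym.
  by apply: contraTT xy => yE; rewrite adj_sym; apply: E_out.
apply/setP => x; rewrite inE; have /forallP/(_ x) dx := Gc d.
by rewrite -[LHS]/(x \in mem E) -(closed_connect Ecl dx).
Qed.

End Pruning.

(** The core of a tree is empty, so pruning must stop at a single vertex, and regrowth can start
    from any single vertex. *)
Lemma tree_graphs_one_vertex (Phi : graph_subspecies) (U : finType) (G : sgraph U) :
    all_connected Phi -> endpoint_closed Phi -> is_tree G ->
  (G \in Phi U) = (one_vertex_graph \in Phi unit).
Proof.
move=> Phi_connected Phi_closed [Gc /acyclicP C0].
have one r : (induced G [set r] \in Phi _) = (one_vertex_graph \in Phi unit).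
  have r1 : r \in [set r] by rewrite inE.
  pose i (_ : {x : U | x \in [set r]}) := tt.
  rewrite -(pullback_bij (i := i) Phi one_vertex_graph).
  - have -> : induced G [set r] = pullback i one_vertex_graph; last by [].
    apply: sgraph_ext => -[x xr] [y yr]; rewrite !adj_pullback adj_irr /=.
    by move: xr yr; rewrite !inE => /eqP-> /eqP->; rewrite adj_irr.
  - move=> [x xr] [y yr] _; apply: val_inj => /=.
    by move: (xr) (yr); rewrite !inE => /eqP-> /eqP->.
  - by case; apply/codomP; exists (exist (fun x => x \in [set r]) r r1).
apply/idP/idP => [/exists_pruned|KP].
  case=> // D [_ DP [/min_degree2_sub_core|[r Dr]]]; last first.
    by rewrite -(one r) -Dr.
  rewrite C0 subset0 => /eqP D0; have /andP[] := Phi_connected _ _ DP.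
  by rewrite card_sig D0 cards0.
have /andP[/card_gt0P[r _] _] := Gc.
apply: (@regrow Phi Phi_connected Phi_closed U G [set r]); rewrite ?C0 ?sub0set ?one //.
by apply/set0Pn; exists r; rewrite inE.
Qed.

(** * Branches hanging off the core *)

Section Branches.
Variables (U : finType) (G : sgraph U).
Implicit Types (x y r s : U) (p : seq U).

Definition off_core : rel U :=
  fun x y => adj G x y && ~~ ((x \in core G) && (y \in core G)).

(** The component of [r] once all edges between two core vertices are removed. *)
Definition branch r : {set U} := [set x | connect off_core r x].

Lemma branch_root r : r \in branch r.
Proof. by rewrite inE connect0. Qed.

Lemma off_core_sym : symmetric off_core.
Proof. by move=> x y; rewrite /off_core adj_sym andbC andbC [(y \in _) && _]andbC. Qed.

Lemma connect_off_core_sym : connect_sym off_core.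
Proof. exact/sym_connect_sym/off_core_sym. Qed.

(** The union of the branches is closed under adjacency: an edge between core vertices ends at the
    root of another branch, and any other edge stays in its branch. *)
Lemma branch_cover : connected G -> core G != set0 ->
  forall x, exists2 r, r \in core G & x \in branch r.
Proof.
move=> /andP[_ /forallP Gc] /set0Pn[r0 r0C] x.
pose E := [set x | [exists r in core G, x \in branch r]].
have Ecl : closed (adj G) (mem E).
  apply: intro_closed => [|y z yz]; first exact/sym_connect_sym/adj_sym.
  rewrite !inE => /exists_inP[r rC yr].
  have [/andP[_ zC]|yzC] := boolP ((y \in core G) && (z \in core G)).
    by apply/exists_inP; exists z; rewrite ?branch_root.
  apply/exists_inP; exists r => //; move: yr; rewrite !inE => /connect_trans; apply.
  by apply: connect1; rewrite /off_core yz.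
have r0E : r0 \in E by rewrite inE; apply/exists_inP; exists r0; rewrite ?branch_root.
have /forallP/(_ x)/(closed_connect Ecl) := Gc r0.
by rewrite /= r0E => /esym; rewrite inE => /exists_inP.
Qed.

(* Adding to the core a path joining two of its vertices off the core would give
   a larger set of minimum degree 2. *)
Lemma branch_core_eq r s :
  r \in core G -> s \in core G -> s \in branch r -> s = r.
Proof.
move=> rC sC; rewrite inE => /connectP[p0 p0p]; case/shortenP: p0p => p pp pu _ sE.
case: p pp pu sE => // y p pp pu sE; exfalso.
(* The path starts at the core vertex [r], and its first edge is not a core edge; so [y] is a vertex
   that the enlarged set has and the core lacks. *)
have yC : y \notin core G by case/andP: pp => /andP[_]; rewrite rC.
suff /min_degree2_sub_core/subsetP/(_ y) : min_degree2 G (core G :|: [set x in y :: p]).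
  by rewrite (negPf yC) !inE eqxx orbT => /(_ isT).
set q := y :: p in pp pu sE *; set D := _ :|: _.
have CD : core G \subset D by apply: subsetUl.
have qD z : z \in r :: q -> z \in D.
  by rewrite inE => /predU1P[->|zq]; rewrite in_setU ?rC // in_set zq orbT.
apply/forall_inP => x; have [xC _|xC] := boolP (x \in core G).
  have := forall_inP (core_min_degree2 G) x xC; move/leq_trans; apply.
  exact/subset_leq_card/nbrs_inS.
rewrite in_setU (negPf xC) in_set => xq.
case/path.splitPr: xq pp pu sE qD => p1 p2; rewrite cat_path last_cat.
case: p2 => [_ _ sx|z p2]; first by rewrite /= in sx; rewrite -sx sC in xC.
move=> /and4P[_ /andP[ux _] /andP[xz _] _] pu _ qD.
(* The two neighbours of [x] are its predecessor and successor on the path; a successor exists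
   because [x] is off the core while the last vertex [s] is in it. *)
apply/nbrs_inP; exists (last r p1), z; split=> //.
- by apply: qD; rewrite -cat_cons mem_cat mem_last.
- by apply: qD; rewrite !(inE, mem_cat) eqxx !orbT.
- by rewrite adj_sym.
have zq : z \in [:: x, z & p2] by rewrite !inE eqxx orbT.
move: pu; rewrite -cat_cons cat_uniq => /and3P[_ /hasPn/(_ z zq) + _].
by apply: contraNneq => <- /=; rewrite mem_last.
Qed.

Lemma branch_eq r s x :
  r \in core G -> s \in core G -> x \in branch r -> x \in branch s -> r = s.
Proof.
move=> rC sC; rewrite !inE => rx sx; apply: branch_core_eq => //.
by rewrite inE (connect_trans sx) // connect_off_core_sym.
Qed.

(** Walks along off-core edges from [r] never leave the branch, whence connectedness. A cycle would
    consist of core vertices, but [r] is the only one in the branch. *)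
Lemma branch_is_tree r : r \in core G -> is_tree (induced G (branch r)).
Proof.
move=> rC; have rB := branch_root r.
pose r' : {x : U | x \in branch r} := exist _ r rB; split.
  have cr : forall x : {x : U | x \in branch r},
      connect (adj (induced G (branch r))) r' x.
    have walk p (x : {x : U | x \in branch r}) :
        path off_core (val x) p -> exists2 y : {y : U | y \in branch r},
        val y = last (val x) p & connect (adj (induced G (branch r))) x y.
      elim: p x => [|y p IHp] x /=; first by exists x.
      move=> /andP[xy yp]; have yB : y \in branch r.
        by have := valP x; rewrite !inE => /connect_trans; apply; apply: connect1.
      have [z zE yz] := IHp (exist _ y yB) yp; exists z => //.
      by apply: connect_trans yz; apply: connect1; rewrite adj_pullback; case/andP: xy.
    move=> x; have := valP x; rewrite inE => /connectP[p pp xE].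
    by have [y yE] := walk p (r') pp; rewrite (val_inj (etrans yE (esym xE))).
  apply/andP; split; first by apply/card_gt0P; exists (r').
  apply/forallP => x; apply/forallP => y; apply: connect_trans (cr y).
  by rewrite sym_connect_sym ?cr //; exact: adj_sym.
move=> c c2 /andP[cc cu].
have vc : ucycle (adj G) (map val c).
  rewrite /ucycle map_inj_uniq ?cu ?andbT; last exact: val_inj.
  by rewrite cycle_map; apply: sub_cycle cc => x y; rewrite adj_pullback.
have vs : 2 < size (map val c) by rewrite size_map.
have /subsetP vcC := min_degree2_sub_core (ucycle_min_degree2 vs vc).
have cr (x : {x : U | x \in branch r}) : x \in c -> val x = r.
  move=> xc; apply: branch_core_eq (valP x) => //.
  by apply: vcC; rewrite inE map_f.
case: c cc cu c2 {vc vs vcC} cr => [|x [|y c]] //= _ /andP[+ _] _ cr.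
by rewrite inE -val_eqE /= !cr ?inE ?eqxx ?orbT.
Qed.

End Branches.

(** * Rooted trees on subsets of the vertex set *)

Notation rooted_subtree U := (substruct rooted_tree_species U).

Section RootedSubtrees.
Variable U : finType.
Implicit Types (t : rooted_subtree U) (x y : U).

Definition tree_of t : sgraph {x : U | x \in tag t} := val (tagged t).1.

Definition root_of t : U := val (tagged t).2.

(** Adjacency as a relation on all of [U], so that trees with different label sets can be compared
    without dependent types. *)
Definition tree_adj t : rel U := fun x y =>
  [exists p : {x : U | x \in tag t} * {x : U | x \in tag t},
    [&& val p.1 == x, val p.2 == y & adj (tree_of t) p.1 p.2]].

Lemma tree_adjP t x y :
  reflect (exists x' y' : {x : U | x \in tag t},
             [/\ val x' = x, val y' = y & adj (tree_of t) x' y'])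
          (tree_adj t x y).
Proof.
apply: (iffP existsP) => [[[x' y'] /and3P[/eqP xE /eqP yE e]]|[x' [y' [xE yE e]]]].
  by exists x', y'.
by exists (x', y'); rewrite /= xE yE e !eqxx.
Qed.

Lemma tree_adj_val t (x y : {x : U | x \in tag t}) :
  tree_adj t (val x) (val y) = adj (tree_of t) x y.
Proof.
apply/tree_adjP/idP => [[x' [y' [/val_inj-> /val_inj->]]]|] //.
by exists x, y.
Qed.

Lemma tree_adj_mem t x y : tree_adj t x y -> x \in tag t /\ y \in tag t.
Proof. by case/tree_adjP=> x' [y' [<- <- _]]; split; apply: valP. Qed.

Lemma tree_adj_sym t : symmetric (tree_adj t).
Proof.
suff s x y : tree_adj t x y -> tree_adj t y x by move=> x y; apply/idP/idP; exact: s.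
by case/tree_adjP=> x' [y' [<- <- e]]; rewrite tree_adj_val adj_sym.
Qed.

Lemma tree_adj_irr t : irreflexive (tree_adj t).
Proof.
move=> x; apply/negbTE/negP => /tree_adjP[x' [y' [<- /val_inj->]]].
by rewrite adj_irr.
Qed.

Lemma tree_ofP t : is_tree (tree_of t).
Proof. by have := valP (tagged t).1; rewrite inE => /asboolP. Qed.

Lemma root_of_mem t : root_of t \in tag t.
Proof. exact: valP. Qed.

Lemma tree_connect t x : x \in tag t -> connect (tree_adj t) (root_of t) x.
Proof.
move=> xt; have [/andP[_ /forallP tc] _] := tree_ofP t.
have /forallP/(_ (exist _ x xt))/connectP[p pp xE] := tc (tagged t).2.
apply/connectP; exists (map val p).
  by rewrite /root_of path_map; apply: sub_path pp => a b /=; rewrite tree_adj_val.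
by rewrite /root_of last_map -xE.
Qed.

Lemma rooted_subtree_ext t1 t2 :
  tag t1 = tag t2 -> root_of t1 = root_of t2 -> tree_adj t1 =2 tree_adj t2 ->
  t1 = t2.
Proof.
case: t1 t2 => [B [g r]] [B' [g' r']] /= eB; subst B' => er eg.
have -> : r = r' by apply: val_inj.
suff -> : g = g' by [].
apply: val_inj; apply: sgraph_ext => x y.
have := eg (val x) (val y).
by rewrite (@tree_adj_val (existT _ B (g, r))) (@tree_adj_val (existT _ B (g', r'))).
Qed.

(** The form of [acyclic_subset1] for a tree on a subset of [U], with its root as the exceptional
    vertex. *)
Lemma tree_subset_root t (D : {set U}) :
    (forall x, x \in tag t -> x \in D -> x != root_of t ->
       exists y z, [/\ y \in D, z \in D, tree_adj t x y, tree_adj t x z & y != z]) ->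
  forall x, x \in tag t -> x \in D -> x = root_of t.
Proof.
move=> D2 x xt xD; have [_ ta] := tree_ofP t.
pose D' := [set x : {x : U | x \in tag t} | val x \in D].
have /subsetP/(_ (exist _ x xt)) : D' \subset [set (tagged t).2].
  apply: acyclic_subset1 ta _ => a; rewrite inE => aD aroot.
  have [y [z [yD zD ay az yz]]] := D2 _ (valP a) aD aroot.
  have [[_ yt] [_ zt]] := (tree_adj_mem ay, tree_adj_mem az).
  apply/nbrs_inP; exists (exist _ y yt), (exist _ z zt).
  by rewrite !inE -!tree_adj_val.
by rewrite !inE => /(_ xD)/eqP xE; rewrite /root_of -xE.
Qed.

End RootedSubtrees.

Lemma root_of_transport (U V : finType) (f : bij U V) (t : rooted_subtree U) :
  root_of (substruct_transport f t) = f (root_of t).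
Proof. by []. Qed.

Lemma tree_adj_transport (U V : finType) (f : bij U V) (t : rooted_subtree U) x y :
  tree_adj (substruct_transport f t) (f x) (f y) = tree_adj t x y.
Proof.
apply/tree_adjP/tree_adjP => -[x' [y' [xE yE e]]].
  exists (binv (bij_restr f (tag t)) x'), (binv (bij_restr f (tag t)) y').
  split; first by rewrite /= xE bfunK.
    by rewrite /= yE bfunK.
  by move: e; rewrite adj_pullback.
exists (bij_restr f (tag t) x'), (bij_restr f (tag t) y').
by rewrite /= xE yE adj_relabel.
Qed.

(** * The rooted trees attached to the core of a graph *)

Section Attached.
Variables (U : finType) (G : sgraph U).
Implicit Types (t : rooted_subtree U).

(** These trees are the blocks of the composite structure that corresponds to [G]; the Boolean form
    lets them be collected in a finite set. *)
Definition attached t : bool :=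
  [&& root_of t \in core G, tag t == branch G (root_of t) &
      [forall x, forall y,
         tree_adj t x y == [&& x \in tag t, y \in tag t & adj G x y]]].

Lemma attachedP t :
  reflect [/\ root_of t \in core G, tag t = branch G (root_of t) &
              forall x y, tree_adj t x y = [&& x \in tag t, y \in tag t & adj G x y]]
          (attached t).
Proof.
apply: (iffP and3P) => [[rC /eqP tE tG]|[rC tE tG]]; split=> //; last 1 first.
- by apply/forallP => x; apply/forallP => y; rewrite tG.
- by move=> x y; move: tG => /forallP/(_ x)/forallP/(_ y)/eqP.
- exact/eqP.
Qed.

(** The root fixes the branch, and [G] fixes the edges in it. *)
Lemma attached_root_inj : {in attached &, injective (@root_of U)}.
Proof.
move=> t1 t2 /attachedP[r1 B1 e1] /attachedP[r2 B2 e2] er.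
have eB : tag t1 = tag t2 by rewrite B1 B2 er.
by apply: rooted_subtree_ext => // x y; rewrite e1 e2 eB.
Qed.

Lemma attached_ex r : r \in core G -> exists2 t, attached t & root_of t = r.
Proof.
move=> rC; have /asboolP := branch_is_tree rC => Bt.
have BT : induced G (branch G r) \in tree_graphs _ by rewrite inE.
pose g : tree_species {x : U | x \in branch G r} :=
  exist (fun H => H \in tree_graphs _) _ BT.
pose t : rooted_subtree U :=
  Tagged (fun D : {set U} => rooted_tree_species {x : U | x \in D} : Type)
    (g, exist _ r (branch_root G r)).
exists t => //; apply/attachedP; split=> // x y.
apply/tree_adjP/and3P => [[x' [y' [<- <-]]]|[xt yt xy]].
  by rewrite adj_pullback; split=> //; apply: valP.
by exists (exist _ x xt), (exist _ y yt); rewrite adj_pullback.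
Qed.

(** Branches cover by connectedness, are disjoint because each contains only one core vertex, and
    are nonempty because they contain their roots. *)
Lemma attached_partition : connected G -> core G != set0 ->
  labels_partition [set t | attached t].
Proof.
move=> Gc C0; apply/andP; split.
  apply/dinjectiveP => t1 t2; rewrite !inE => a1 a2 e; apply: attached_root_inj => //.
  have /attachedP[r1 B1 _] := a1; have /attachedP[r2 B2 _] := a2.
  apply: (@branch_eq _ G _ _ (root_of t1)) => //; rewrite -?B1 -?B2 ?root_of_mem //.
  by rewrite -[tag t2]e root_of_mem.
apply/and3P; split.
- apply/eqP/setP => x; rewrite inE; apply/bigcupP.
  have [r rC xr] := branch_cover Gc C0 x; have [t ta tr] := attached_ex rC.
  exists (tag t); first by apply: imset_f; rewrite inE.
  by have /attachedP[_ -> _] := ta; rewrite tr.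
- apply/trivIsetP => _ _ /imsetP[t1 + ->] /imsetP[t2 + ->].
  rewrite !inE => /attachedP[r1 B1 _] /attachedP[r2 B2 _]; apply: contraNT.
  case/pred0Pn=> x /andP[]; rewrite /label_set /= B1 B2 => x1 x2.
  by rewrite (branch_eq r1 r2 x1 x2).
- apply/imsetP => -[t _ t0]; have := root_of_mem t.
  by rewrite -[tag t]t0 inE.
Qed.

End Attached.

(** * Gluing rooted trees along a graph on the set of trees *)

Section Glue.
Variable Psi : graph_subspecies.

Section GlueDef.
Variables (U : finType) (s : substruct (species_of Psi) (rooted_subtree U)).
Implicit Types (x y : U).

(** The outer graph of the composite structure: its vertices are the rooted trees, and gluing turns
    its edges into edges between their roots. *)
Definition skeleton : sgraph {t : rooted_subtree U | t \in tag s} := val (tagged s).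

Definition skeleton_adj : rel U := fun x y =>
  [exists p : {t : rooted_subtree U | t \in tag s} * {t : rooted_subtree U | t \in tag s},
    [&& root_of (val p.1) == x, root_of (val p.2) == y & adj skeleton p.1 p.2]].

Lemma skeleton_adjP x y :
  reflect (exists p q : {t : rooted_subtree U | t \in tag s},
             [/\ root_of (val p) = x, root_of (val q) = y & adj skeleton p q])
          (skeleton_adj x y).
Proof.
apply: (iffP existsP) => [[[p q] /and3P[/eqP xE /eqP yE e]]|[p [q [xE yE e]]]].
  by exists p, q.
by exists (p, q); rewrite /= xE yE e !eqxx.
Qed.

Lemma skeleton_adj_sym : symmetric skeleton_adj.
Proof.
suff sy x y : skeleton_adj x y -> skeleton_adj y x
  by move=> x y; apply/idP/idP; exact: sy.
by case/skeleton_adjP=> p [q [<- <- e]]; apply/skeleton_adjP; exists q, p;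
  rewrite adj_sym.
Qed.

Definition glue_adj : rel U := fun x y =>
  [exists t in tag s, tree_adj t x y] || skeleton_adj x y.

(* [x != y] is automatic when the label sets of [s] partition [U]; it makes
   [glue] total. *)
Lemma glue_subproof :
  simple_arcs [set p : U * U | (p.1 != p.2) && glue_adj p.1 p.2].
Proof.
apply/andP; split; first by apply/forallP => x; rewrite inE eqxx.
apply/forallP => x; apply/forallP => y; rewrite !inE /= eq_sym.
rewrite /glue_adj skeleton_adj_sym.
by under eq_existsb do rewrite tree_adj_sym; rewrite implybb.
Qed.

Definition glue : sgraph U := SGraph glue_subproof.

Lemma adj_glue x y : adj glue x y = (x != y) && glue_adj x y.
Proof. by rewrite {1}/adj inE. Qed.

End GlueDef.

Lemma glue_transport (U V : finType) (f : bij U V)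
    (s : substruct (species_of Psi) (rooted_subtree U)) :
  glue (substruct_transport (transport_bij (substruct_species rooted_tree_species) f) s) =
  relabel f (glue s).
Proof.
set s' := substruct_transport _ _; apply: sgraph_ext => x0 y0.
rewrite adj_pullback -{1}(binvK f x0) -{1}(binvK f y0).
move: (binv f x0) (binv f y0) => x y {x0 y0}.
rewrite !adj_glue (inj_eq (@Defs.bij_inj _ _ f)); congr (_ && (_ || _)).
  apply/exists_inP/exists_inP => [[_ /imsetP[t ts ->] e]|[t ts e]].
    by exists t => //; move: e; rewrite tree_adj_transport.
  by exists (substruct_transport f t); rewrite ?tree_adj_transport // imset_f.
pose e := bij_restr (transport_bij (substruct_species rooted_tree_species) f) (tag s).
apply/skeleton_adjP/skeleton_adjP => -[p [q [px qy pq]]].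
  exists (binv e p), (binv e q); split; last by move: pq; rewrite adj_pullback.
    by apply: (@Defs.bij_inj _ _ f); rewrite -root_of_transport -px -[in RHS](binvK e p).
  by apply: (@Defs.bij_inj _ _ f); rewrite -root_of_transport -qy -[in RHS](binvK e q).
by exists (e p), (e q); rewrite -px -qy adj_relabel.
Qed.

(** * Core and branches of a glued graph *)

Section Glued.
Variables (U : finType) (s : substruct (species_of Psi) (rooted_subtree U)).
Hypothesis sP : labels_partition (tag s).
Implicit Types (t : rooted_subtree U) (x y : U).

Lemma block_ex x : exists2 t, t \in tag s & x \in tag t.
Proof.
have /andP[_ /and3P[/eqP cov _ _]] := sP.
have : x \in cover [set label_set t | t in tag s] by rewrite cov.
by case/bigcupP=> _ /imsetP[t ts ->]; exists t.
Qed.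

Lemma block_uniq t1 t2 x :
  t1 \in tag s -> t2 \in tag s -> x \in tag t1 -> x \in tag t2 -> t1 = t2.
Proof.
have /andP[/dinjectiveP inj /and3P[_ /trivIsetP triv _]] := sP.
move=> t1s t2s x1 x2; apply: inj => //; apply/eqP/negPn/negP.
move/(triv _ _ (imset_f _ t1s) (imset_f _ t2s))/pred0P/(_ x).
by rewrite /= /label_set x1 x2.
Qed.

Lemma root_of_inj : {in tag s &, injective (@root_of U)}.
Proof.
move=> t1 t2 t1s t2s e; apply: (@block_uniq _ _ (root_of t1)) => //.
  exact: root_of_mem.
by rewrite e root_of_mem.
Qed.

(** The condition [x != y] is automatic: tree edges are irreflexive, and trees of the partition with
    equal roots coincide, so a loop at a root would be a loop of the skeleton. *)
Lemma glueP x y :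
  reflect ((exists2 t, t \in tag s & tree_adj t x y) \/ skeleton_adj s x y)
          (adj (glue s) x y).
Proof.
rewrite adj_glue; apply: (iffP andP).
  by move=> [_ /orP[/exists_inP|]]; [left|right].
move=> xy; split; last by apply/orP; case: xy => [/exists_inP|]; [left|right].
apply/eqP => e; subst y; case: xy => [[t _]|]; first by rewrite tree_adj_irr.
case/skeleton_adjP=> p [q [px qx]].
have -> : p = q; last by rewrite adj_irr.
by apply: val_inj; apply: root_of_inj (valP p) (valP q) _; rewrite px qx.
Qed.

(** A skeleton edge inside one block would join a tree to itself, and a tree edge touching the block
    belongs to its own tree. *)
Lemma adj_glue_block t x y : t \in tag s -> x \in tag t -> y \in tag t ->
  adj (glue s) x y = tree_adj t x y.
Proof.
move=> ts xt yt; apply/glueP/idP => [|e]; last by left; exists t.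
case=> [[t' t's e]|/skeleton_adjP[p [q [px qy pq]]]].
  have [xt' _] := tree_adj_mem e.
  by rewrite (block_uniq ts t's xt xt').
have pt : val p = t.
  by apply: block_uniq (valP p) ts _ xt; rewrite -px root_of_mem.
have qt : val q = t.
  by apply: block_uniq (valP q) ts _ yt; rewrite -qy root_of_mem.
by move: pq; rewrite (val_inj (etrans pt (esym qt))) adj_irr.
Qed.

(** A tree edge between two roots would put both in one block, making them the same root. *)
Lemma skeleton_glue : skeleton s = pullback (fun p => root_of (val p)) (glue s).
Proof.
apply: sgraph_ext => p q; rewrite adj_pullback; apply/idP/glueP => [pq|].
  by right; apply/skeleton_adjP; exists p, q.
case=> [[t ts e]|/skeleton_adjP[p' [q' [pE qE]]]].
  have [pt qt] := tree_adj_mem e.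
  have pE := block_uniq (valP p) ts (root_of_mem _) pt.
  have qE := block_uniq (valP q) ts (root_of_mem _) qt.
  by move: e; rewrite pE qE tree_adj_irr.
have -> : p' = p by apply/val_inj/root_of_inj => //; exact: valP.
by have -> : q' = q by apply/val_inj/root_of_inj => //; exact: valP.
Qed.

Lemma glue_connected : connected (skeleton s) -> connected (glue s).
Proof.
move=> /andP[/card_gt0P[p0 _] /forallP Hc].
pose root (p : {t : rooted_subtree U | t \in tag s}) := root_of (val p).
have cr p q : connect (adj (glue s)) (root p) (root q).
  have /forallP/(_ q)/connectP[l lp ->] := Hc p.
  apply/connectP; exists (map root l); last by rewrite last_map.
  by rewrite path_map; apply: sub_path lp => a b; rewrite skeleton_glue adj_pullback.
have gsym := sym_connect_sym (adj_sym (glue s)).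
have cx p x : connect (adj (glue s)) (root p) x.
  have [t ts xt] := block_ex x.
  apply: connect_trans (cr p (exist _ t ts)) _.
  apply: connect_sub (tree_connect xt) => a b ab.
  by apply/connect1/glueP; left; exists t.
apply/andP; split; first by apply/card_gt0P; exists (root p0).
apply/forallP => x; apply/forallP => y.
by apply: connect_trans (cx p0 y); rewrite gsym.
Qed.

Hypothesis skeleton_degree : forall p, 1 < degree (skeleton s) p.

(** The roots inherit minimum degree 2 from the skeleton, so they lie in the core. A vertex that is
    not a root has only tree edges, so the core meets each block in its root alone. *)
Lemma glue_core : core (glue s) = [set root_of t | t in tag s].
Proof.
apply/eqP; rewrite eqEsubset; apply/andP; split; last first.
  apply: min_degree2_sub_core; apply/forall_inP => _ /imsetP[t ts ->].
  have /card_gt1P[p [q []]] := skeleton_degree (exist _ t ts).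
  rewrite !inE skeleton_glue !adj_pullback => tp tq pq; apply/nbrs_inP.
  exists (root_of (val p)), (root_of (val q)).
  rewrite !imset_f ?(valP p) ?(valP q) //; split=> //.
  by apply: contra pq => /eqP/root_of_inj e; apply/eqP/val_inj/e; apply: valP.
apply/subsetP => x xC; have [t ts xt] := block_ex x; apply/imsetP; exists t => //.
apply: tree_subset_root xt xC => {}x xt xC x_r.
have /nbrs_inP[y [z [yC zC xy xz yz]]] := forall_inP (core_min_degree2 _) x xC.
suff tr u : adj (glue s) x u -> tree_adj t x u by exists y, z; split=> //; exact: tr.
case/glueP=> [[t' t's e]|/skeleton_adjP[p [q [px _ _]]]].
  have [xt' _] := tree_adj_mem e.
  by rewrite (block_uniq ts t's xt xt').
case/eqP: x_r; rewrite -px; congr root_of.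
by apply: block_uniq (valP p) ts _ xt; rewrite -px root_of_mem.
Qed.

(** Tree edges are off-core, since a block has only its root in the core. Skeleton edges join core
    vertices, so no off-core edge leaves a block. *)
Lemma glue_branch t : t \in tag s -> tag t = branch (glue s) (root_of t).
Proof.
move=> ts; have rootC t' x : t' \in tag s -> x \in tag t' ->
    x \in core (glue s) -> x = root_of t'.
  rewrite glue_core => t's xt' /imsetP[t2 t2s xE]; rewrite xE.
  by congr root_of; apply: block_uniq t2s t's _ xt'; rewrite xE root_of_mem.
apply/setP => x; apply/idP/idP => [xt|].
  rewrite inE; apply: connect_sub (tree_connect xt) => a b ab; apply: connect1.
  have [at_ bt] := tree_adj_mem ab.
  rewrite /off_core (adj_glue_block ts) // ab; apply/negP => /andP[aC bC].
  by move: ab; rewrite (rootC _ _ ts at_ aC) (rootC _ _ ts bt bC) tree_adj_irr.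
have cl : closed (off_core (glue s)) (mem (tag t)).
  apply: intro_closed; first exact: connect_off_core_sym.
  move=> a b /andP[/glueP[[t' t's e]|e] ab] at_.
    have [at' bt'] := tree_adj_mem e.
    by rewrite (block_uniq ts t's at_ at').
  case/skeleton_adjP: e ab => p [q [<- <- _]].
  by rewrite glue_core !imset_f // ?(valP p) ?(valP q).
rewrite inE => /(closed_connect cl) <-; exact: root_of_mem.
Qed.

Lemma glue_attached : tag s = [set t | attached (glue s) t].
Proof.
have sub t : t \in tag s -> attached (glue s) t.
  move=> ts; apply/attachedP; split; first by rewrite glue_core imset_f.
    exact: glue_branch.
  move=> x y; apply/idP/and3P => [xy|[xt yt]]; last by rewrite (adj_glue_block ts).
  by have [xt yt] := tree_adj_mem xy; rewrite (adj_glue_block ts).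
apply/setP => t; rewrite inE; apply/idP/idP => [/sub //|ta].
have /attachedP[+ _ _] := ta; rewrite glue_core => /imsetP[t' t's tE].
by rewrite (attached_root_inj ta (sub _ t's) tE).
Qed.

End Glued.

(** The glued graph determines the set of trees, as its attached trees, and then the skeleton, as
    its pullback along the roots. *)
Lemma glue_inj (U : finType) (s1 s2 : substruct (species_of Psi) (rooted_subtree U)) :
    labels_partition (tag s1) -> labels_partition (tag s2) ->
    (forall p, 1 < degree (skeleton s1) p) -> (forall p, 1 < degree (skeleton s2) p) ->
  glue s1 = glue s2 -> s1 = s2.
Proof.
move=> P1 P2 d1 d2 e; have eT : tag s1 = tag s2.
  by rewrite (glue_attached P1 d1) (glue_attached P2 d2) e.
have := (skeleton_glue P1, skeleton_glue P2); rewrite -{}e.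
case: s1 s2 {P1 P2 d1 d2} eT => [T1 h1] [T2 h2] /= eT; subst T2 => -[e1 e2].
by congr existT; apply: val_inj; rewrite -[LHS]/(skeleton (existT _ T1 h1)) e1 -e2.
Qed.

End Glue.

(** * Gluing as a bijection onto the graphs with nonempty core *)

Section GlueGraphs.
Variables Phi Psi : graph_subspecies.
Hypotheses (Phi_connected : all_connected Phi) (Phi_closed : endpoint_closed Phi).
(** The property of the outer species shared by both cases of the theorem, so that gluing is treated
    once. *)
Hypothesis PsiP : forall (U : finType) (H : sgraph U),
  H \in Psi U <-> H \in Phi U /\ forall x, 1 < degree H x.

Definition glue_comp (U : finType)
    (c : comp_species (species_of Psi) rooted_tree_species U) : sgraph U :=
  glue (val c).

Section OnU.
Variable U : finType.
Implicit Types (c : comp_species (species_of Psi) rooted_tree_species U).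

Lemma skeletonP c :
  skeleton (val c) \in Phi _ /\ forall p, 1 < degree (skeleton (val c)) p.
Proof. exact/PsiP/(valP (tagged (val c))). Qed.

Lemma glue_comp_inj : injective (@glue_comp U).
Proof.
move=> c1 c2 e; apply: val_inj; have [_ d1] := skeletonP c1; have [_ d2] := skeletonP c2.
by apply: glue_inj e; rewrite ?(valP c1) ?(valP c2).
Qed.

Lemma core_glue_comp c : core (glue_comp c) != set0.
Proof.
have [HP Hd] := skeletonP c; have /andP[/card_gt0P[p _] _] := Phi_connected HP.
apply/set0Pn; exists (root_of (val p)).
by rewrite (glue_core (valP c) Hd) imset_f // (valP p).
Qed.

(** The skeleton is a copy of the graph induced on the core, from which the glued graph is
    regrown. *)
Lemma glue_comp_graphs c : glue_comp c \in Phi U.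
Proof.
have [HP Hd] := skeletonP c.
apply: (regrow Phi_connected Phi_closed _ (core_glue_comp c) (subxx _)).
  exact/(glue_connected (valP c))/Phi_connected.
move: HP; rewrite (skeleton_glue (valP c)); apply: pullback_graphs.
- by move=> p q e; apply/val_inj/(root_of_inj (valP c)) => //; apply: valP.
- exact: val_inj.
move=> x; apply/codomP/codomP => [[p ->]|[[y yC] ->] /=].
  have pC : root_of (val p) \in core (glue_comp c).
    by rewrite (glue_core (valP c) Hd) imset_f // (valP p).
  by exists (exist (fun x => x \in core (glue_comp c)) _ pC).
move: yC; rewrite (glue_core (valP c) Hd) => /imsetP[t ts ->].
by exists (exist (fun t => t \in tag (val c)) t ts).
Qed.

(** Pruning stops at a set containing the core; it is not a single vertex since a nonempty core has
    at least two, so it has minimum degree 2 and equals the core. *)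
Lemma induced_core (G : sgraph U) :
  G \in Phi U -> core G != set0 -> induced G (core G) \in Phi _.
Proof.
move=> /(exists_pruned Phi_connected Phi_closed)[D [CD DP D2]] C0.
suff DC : D = core G by rewrite -DC.
apply/eqP; rewrite eqEsubset CD andbT.
case: D2 => [/min_degree2_sub_core //|[r Dr]].
by have := leq_trans (card_core C0) (subset_leq_card CD); rewrite Dr cards1.
Qed.

(** The preimage consists of the attached trees, with [G] pulled back along their roots as
    skeleton. *)
Lemma glue_comp_surj (G : sgraph U) :
  G \in Phi U -> core G != set0 -> exists c, glue_comp c = G.
Proof.
move=> GP C0; have Gc := Phi_connected GP.
pose T := [set t : rooted_subtree U | attached G t].
have TP : labels_partition T := attached_partition Gc C0.
have Ta (p : {t | t \in T}) : attached G (val p) by have := valP p; rewrite inE.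
have Tr r : r \in core G -> exists p : {t | t \in T}, root_of (val p) = r.
  case/attached_ex=> t ta tr; have tT : t \in T by rewrite inE.
  by exists (exist (fun t => t \in T) t tT).
pose root (p : {t | t \in T}) := root_of (val p).
have root_core p : root p \in core G by case/attachedP: (Ta p).
have root_inj : injective root.
  by move=> p q e; apply/val_inj/(attached_root_inj (Ta p) (Ta q)).
have HP : pullback root G \in Psi _.
  apply/PsiP; split.
    move: (induced_core GP C0); apply: pullback_graphs => //; first exact: val_inj.
    move=> x; apply/codomP/codomP => [[y ->]|[p ->]].
      by have [p <-] := Tr _ (valP y); exists p.
    by exists (exist (fun x => x \in core G) _ (root_core p)).
  move=> p; have := forall_inP (core_min_degree2 G) _ (root_core p).
  case/nbrs_inP=> y [z [/Tr[py <-] /Tr[pz <-] pyE pzE yz]].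
  apply/card_gt1P; exists py, pz; rewrite !inE !adj_pullback; split=> //.
  by apply: contraNneq yz => ->.
pose h : species_of Psi {t | t \in T} := exist (fun H => H \in Psi _) _ HP.
pose s : substruct (species_of Psi) (rooted_subtree U) :=
  Tagged (fun B : {set rooted_subtree U} =>
    species_of Psi {t : rooted_subtree U | t \in B} : Type) h.
have sP : labels_partition (tag s) := TP.
exists (exist _ s sP); apply: sgraph_ext => x y; apply/(glueP sP)/idP.
  case=> [[t]|/skeleton_adjP[p [q [<- <-]]]]; last by rewrite adj_pullback.
  by rewrite inE => /attachedP[_ _ ->] /and3P[].
(* An edge between core vertices comes from the skeleton; any other edge lies within one branch. *)
move=> xy; have [/andP[xC yC]|nC] := boolP ((x \in core G) && (y \in core G)).
  right; have [[p px] [q qy]] := (Tr x xC, Tr y yC).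
  by apply/skeleton_adjP; exists p, q; rewrite adj_pullback /root px qy.
left; have [r rC xr] := branch_cover Gc C0 x; have [t ta tr] := attached_ex rC.
exists t; first by rewrite inE.
have /attachedP[_ tB ->] := ta; rewrite xy tB tr xr /= andbT.
move: xr; rewrite !inE => /connect_trans; apply; apply: connect1.
by rewrite /off_core xy.
Qed.

End OnU.

Lemma glue_comp_transport (U V : finType) (f : bij U V)
    (c : comp_species (species_of Psi) rooted_tree_species U) :
  glue_comp (transport (comp_species (species_of Psi) rooted_tree_species) f c) =
  relabel f (glue_comp c).
Proof. exact: glue_transport. Qed.

End GlueGraphs.

(** * The two choices of outer species and the final isomorphism *)

Lemma at_least_two_no_endpointsP (Phi : graph_subspecies) (U : finType) (H : sgraph U) :
    all_connected Phi ->
  H \in at_least_two (no_endpoints Phi) U <-> H \in Phi U /\ forall x, 1 < degree H x.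
Proof.
move=> Phi_connected; rewrite !inE; split=> [/andP[/andP[HP /forallP He] U2]|[HP Hd]].
  by split=> //; apply: connected_degree_gt1 => //; exact: Phi_connected.
rewrite HP /=; apply/andP; split.
  by apply/forallP => x; rewrite /endpoint neq_ltn Hd orbT.
have /andP[/card_gt0P[x _] _] := Phi_connected _ _ HP.
exact: leq_trans (Hd x) (max_card _).
Qed.

(** A connected graph on one vertex is a tree, so it would make the one-vertex graph a member of
    [Phi]; hence having at least two vertices is automatic. *)
Lemma no_endpointsP (Phi : graph_subspecies) (U : finType) (H : sgraph U) :
    all_connected Phi -> endpoint_closed Phi -> one_vertex_graph \notin Phi unit ->
  H \in no_endpoints Phi U <-> H \in Phi U /\ forall x, 1 < degree H x.
Proof.
move=> Phi_connected Phi_closed K1; rewrite -at_least_two_no_endpointsP //.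
rewrite [X in _ <-> is_true X]inE; split=> [HP|/andP[]//]; rewrite HP /= ltnNge.
apply: contra K1 => U1; move: HP; rewrite inE => /andP[HP _].
rewrite -(tree_graphs_one_vertex (G := H)) //; split; first exact: Phi_connected.
apply/acyclicP/eqP/negPn/negP => /card_core.
by rewrite ltnNge (leq_trans (max_card _) U1).
Qed.

Theorem theorem5p17 (Phi : graph_subspecies)
    (Phi_connected : all_connected Phi)
    (Phi_closed : endpoint_closed Phi) :
  species_iso (species_of Phi)
    (if one_vertex_graph \in Phi unit then
       sum_species
         (comp_species (species_of (at_least_two (no_endpoints Phi)))
                       rooted_tree_species)
         tree_species
     else
       comp_species (species_of (no_endpoints Phi)) rooted_tree_species).
Proof.
have treeE U (G : sgraph U) :
    is_tree G -> (G \in Phi U) = (one_vertex_graph \in Phi unit) :=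
  tree_graphs_one_vertex Phi_connected Phi_closed.
(* Gluing maps the composite to [Phi], so the isomorphism is built in that direction. *)
apply: species_iso_sym; case: ifPn => K1.
  have PsiP U (H : sgraph U) := at_least_two_no_endpointsP H Phi_connected.
  set Psi := at_least_two _ in PsiP *.
  pose F := sum_species (comp_species (species_of Psi) rooted_tree_species) tree_species.
  pose graph_of U (c : F U) : sgraph U :=
    match c with inl c => glue_comp c | inr t => val t end.
  have treeP U (t : tree_species U) : is_tree (val t).
    by have := valP t; rewrite inE => /asboolP.
  have graph_ofP U (c : F U) : graph_of U c \in Phi U.
    case: c => [c|t] /=; first exact: (glue_comp_graphs Phi_connected Phi_closed PsiP).
    by rewrite (treeE _ _ (treeP U t)).
  (* The summands do not overlap: glued graphs have nonempty core, trees have empty core. *)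
  have disj U (c : comp_species (species_of Psi) rooted_tree_species U)
      (t : tree_species U) : glue_comp c <> val t :> sgraph U.
    move=> e; have := core_glue_comp Phi_connected PsiP c.
    by have [_ /acyclicP] := treeP _ t; rewrite -e => ->; rewrite eqxx.
  exists (fun U c => exist (fun H => H \in Phi U) _ (graph_ofP U c)).
  split=> [U|U V f [c|t]]; last by apply: val_inj.
    apply: inj_surj_bij => [[c1|t1] [c2|t2] /(congr1 val) /= e|[G GP]].
    - by rewrite (glue_comp_inj PsiP e).
    - by case: (disj _ _ _ e).
    - by case: (disj _ _ _ (esym e)).
    - by rewrite (val_inj e).
    (* An empty core puts [G] in the tree summand, a nonempty one in the composite. *)
    have [C0|C0] := eqVneq (core G) set0.
      have Gt : G \in tree_subspecies U.
        rewrite inE; apply/asboolP; split; first exact: Phi_connected GP.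
        exact/acyclicP.
      by exists (inr (exist (fun H => H \in tree_subspecies U) G Gt)); apply: val_inj.
    have [c cG] := glue_comp_surj Phi_connected Phi_closed PsiP GP C0.
    by exists (inl c); apply: val_inj.
  by apply: val_inj; exact: glue_comp_transport.
have PsiP U (H : sgraph U) := no_endpointsP H Phi_connected Phi_closed K1.
have graph_ofP U
    (c : comp_species (species_of (no_endpoints Phi)) rooted_tree_species U) :
  glue_comp c \in Phi U by apply: (glue_comp_graphs Phi_connected Phi_closed PsiP).
exists (fun U c => exist (fun H => H \in Phi U) _ (graph_ofP U c)).
split=> [U|U V f c]; last by apply: val_inj; exact: glue_comp_transport.
apply: inj_surj_bij => [c1 c2 /(congr1 val) /= e|[G GP]].
  exact: (glue_comp_inj PsiP e).
(* With an empty core [G] would be a tree, forcing the one-vertex graph into [Phi]. *)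
have C0 : core G != set0.
  apply: contraNneq K1 => C0; rewrite -(treeE _ G) //; split; last exact/acyclicP.
  exact: Phi_connected GP.
have [c cG] := glue_comp_surj Phi_connected Phi_closed PsiP GP C0.
by exists c; apply: val_inj.
Qed.
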